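(* Let $X$ be a uniformly convex Banach space and let $A$ be a nontrivial bounded centerable subset of $X$ containing its Chebyshev center $c_A$. Then $A$ is CCNF.
   Context: For a nonempty bounded set $A \subseteq X$ and $x \in X$, put $r(x,A) = \sup_{a \in A}\|x-a\|$ and $F(x,A) = \{a \in A : \|x-a\| = r(x,A)\}$, and let $\mathrm{Far}\,A = \bigcup_{x \in X} F(x,A)$. The Chebyshev radius of $A$ is $r(A) = \inf_{x \in X} r(x,A)$; a point $c \in X$ with $r(c,A) = r(A)$ is called a Chebyshev center of $A$. (In a uniformly convex Banach space every nonempty bounded set has a unique Chebyshev center.) A set is nontrivial if it has at least two elements. $A$ is a CCF set if some Chebyshev center of $A$ belongs to $\mathrm{Far}\,A$, and a CCNF set otherwise. $A$ is centerable if $r(A) = \frac12 \mathrm{diam}(A)$, where $\mathrm{diam}(A) = \sup_{a_1,a_2 \in A}\|a_1-a_2\|$. A Banach space $X$ with closed unit ball $B_X$ is uniformly convex if for every two sequences $\{x_n\}, \{y_n\}$ in $B_X$, $\lim_{n\to\infty}\|x_n+y_n\| = 2$ implies $\lim_{n\to\infty}\|x_n-y_n\| = 0$. *)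

(* Defs.v *)
From HB Require Import structures.
From mathcomp Require Import all_boot all_order all_algebra.
From mathcomp Require Import all_classical all_reals all_analysis.

Set Implicit Arguments.
Unset Strict Implicit.
Unset Printing Implicit Defensive.

Import Order.TTheory GRing.Theory Num.Theory.
Import numFieldNormedType.Exports.

Local Open Scope classical_set_scope.
Local Open Scope ring_scope.

(* [sup] and [inf] are real-valued, with default value 0 when the supremum or
   infimum does not exist; the definitions below are meaningful for nonempty
   bounded [A]. *)
Section FarthestPoints.
Context {R : realType} {X : normedModType R}.
Implicit Types (A : set X) (x c : X).

Definition radius_at x A : R := sup [set `|x - a| | a in A].

Definition farthest x A : set X :=
  [set a | A a /\ `|x - a| = radius_at x A].

Definition Far A : set X := \bigcup_(x in [set: X]) farthest x A.

Definition chebyshev_radius A : R := inf [set radius_at x A | x in [set: X]].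

Definition chebyshev_center A c : Prop := radius_at c A = chebyshev_radius A.

Definition diam A : R := sup [set `|a1 - a2| | a1 in A & a2 in A].

Definition nontrivial A : Prop := exists a1 a2, [/\ A a1, A a2 & a1 <> a2].

Definition CCF A : Prop := exists c, chebyshev_center A c /\ Far A c.

Definition CCNF A : Prop := ~ CCF A.

Definition centerable A : Prop := chebyshev_radius A = 2^-1 * diam A.

End FarthestPoints.

Definition uniformly_convex {R : realType} (X : normedModType R) : Prop :=
  forall x y : nat -> X,
    (forall n, closed_ball (0 : X) 1 (x n)) ->
    (forall n, closed_ball (0 : X) 1 (y n)) ->
    (fun n => `|x n + y n|) @ \oo --> (2 : R) ->
    (fun n => `|x n - y n|) @ \oo --> (0 : R).

(* Main.v *)
Require Import Defs.
From HB Require Import structures.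
From mathcomp Require Import all_boot all_order all_algebra.
From mathcomp Require Import all_classical all_reals all_analysis.

Set Implicit Arguments.
Unset Strict Implicit.
Unset Printing Implicit Defensive.

Import Order.TTheory GRing.Theory Num.Theory.
Import numFieldNormedType.Exports.

Local Open Scope classical_set_scope.
Local Open Scope ring_scope.

(* Let c be a Chebyshev center of radius r lying in A and farthest from x. Pick
   a_n, b_n in A with |a_n - b_n| -> diam A = 2r. Uniform convexity in the ball
   of radius r around c forces |a_n + b_n - 2c| -> 0. Hence
   |(x - a_n) + (x - b_n)| -> 2|x - c|, while a_n and b_n lie within |x - c| of
   x, so uniform convexity in that ball forces |a_n - b_n| -> 0, which is
   absurd. *)

Section BoundedSets.
Context {R : realType} {X : normedModType R}.
Implicit Types (A : set X) (x a : X).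

Lemma bounded_set_norm_le A :
  bounded_set A -> exists M : R, forall a, A a -> `|a| <= M.
(* [bounded_set] gives bounds only strictly above its threshold [M], hence the [+ 1]. *)
Proof. by move=> [M [_ AM]]; exists (M + 1) => a; apply: AM; rewrite ltrDl. Qed.

(** Boundedness makes the supremum exist; otherwise [sup] would take its default value 0. *)
Lemma radius_at_ub A x a : bounded_set A -> A a -> `|x - a| <= radius_at x A.
Proof.
move=> /bounded_set_norm_le[M AM] Aa; apply: ub_le_sup; last by exists a.
exists (`|x| + M) => _ [b Ab <-].
by rewrite (le_trans (ler_normB _ _))// lerD2l AM.
Qed.

Lemma radius_at_gt0 A x : nontrivial A -> bounded_set A -> 0 < radius_at x A.
Proof.
move=> [a [b [Aa Ab ab]]] Abnd; rewrite ltNge; apply/negP => r0; apply: ab.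
have eqx d : A d -> x = d.
  move=> Ad; apply/eqP; rewrite -subr_eq0 -normr_le0.
  exact: le_trans (radius_at_ub _ Abnd Ad) r0.
by rewrite -(eqx _ Aa) -(eqx _ Ab).
Qed.

(** Choose pairs whose distance is within [1/(n+1)] of the supremum, then squeeze. *)
Lemma diam_approx A : A !=set0 -> bounded_set A ->
  exists a b : nat -> X, [/\ forall n, A (a n), forall n, A (b n) &
    (fun n => `|a n - b n|) @ \oo --> diam A].
Proof.
move=> [a0 Aa0] /bounded_set_norm_le[M AM].
set D := [set `|a1 - a2| | a1 in A & a2 in A].
have supD : has_sup D.
  split; first by exists `|a0 - a0|, a0 => //; exists a0.
  exists (M + M) => _ [a Aa [b Ab <-]].
  by rewrite (le_trans (ler_normB _ _))// lerD ?AM.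
have approx n : exists p : X * X,
    [/\ A p.1, A p.2 & diam A - n.+1%:R^-1 < `|p.1 - p.2|].
  have [|_ [a Aa [b Ab <-]] ltab] := @sup_adherent R D n.+1%:R^-1 _ supD.
    by rewrite invr_gt0.
  by exists (a, b).
have [p pP] := choice approx.
exists (fun n => (p n).1), (fun n => (p n).2).
split=> [n|n|]; [by have [] := pP n | by have [] := pP n |].
apply: (@squeeze_cvgr _ _ _ _ (fun n => diam A - n.+1%:R^-1) (fun=> diam A)).
- apply: nearW => n; have [A1 A2 /ltW ->] /= := pP n.
  apply: (ub_le_sup supD.2); exists (p n).1 => //; by exists (p n).2.
- rewrite -[X in _ --> X]subr0; apply: cvgB; first exact: cvg_cst.
  exact: cvg_harmonic.
- exact: cvg_cst.
Qed.

(** Dividing by [s] moves both sequences into the unit ball, and all norms scale accordingly. *)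
Lemma uniformly_convex_scale (s : R) (x y : nat -> X) : uniformly_convex X ->
  0 < s -> (forall n, `|x n| <= s) -> (forall n, `|y n| <= s) ->
  (fun n => `|x n + y n|) @ \oo --> 2 * s ->
  (fun n => `|x n - y n|) @ \oo --> (0 : R).
Proof.
move=> ucX s0 xs ys xy; have sN0 : s != 0 by rewrite gt_eqF.
have normZ (z : X) : `|s^-1 *: z| = s^-1 * `|z|.
  by rewrite normrZ gtr0_norm// invr_gt0.
have ball1 (z : nat -> X) : (forall n, `|z n| <= s) ->
    forall n, closed_ball (0 : X) 1 (s^-1 *: z n).
  move=> zs n; rewrite closed_ballE//= /closed_ball_/= sub0r normrN normZ.
  by rewrite mulrC ler_pdivrMr// mul1r.
have xy1 : (fun n => `|s^-1 *: x n + s^-1 *: y n|) @ \oo --> (2 : R).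
  under eq_fun do rewrite -scalerDr normZ.
  have -> : 2 = s^-1 * (2 * s) by rewrite mulrCA mulVf// mulr1.
  exact: cvgMl_tmp.
(* Each norm becomes [s] times the norm of the rescaled difference, so the limit 0 is read as
   [s * 0]. *)
under eq_fun do rewrite -(mulVKf sN0 `|_|) -normZ scalerBr.
rewrite -[0](mulr0 s).
apply: cvgMl_tmp; exact: (ucX _ _ (ball1 _ xs) (ball1 _ ys) xy1).
Qed.

End BoundedSets.

Theorem theorem2p11 (R : realType) (X : completeNormedModType R)
    (hX : uniformly_convex X) (A : set X) (c : X)
    (A_nontrivial : nontrivial A) (A_bounded : bounded_set A)
    (A_centerable : centerable A)
    (c_center : chebyshev_center A c) (A_c : A c) :
  CCNF A.
Proof.
(* The center provided by [CCF] takes the name [c]; as a point of [Far A] it lies in [A] and is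
   farthest from some [x]. *)
move=> [{c_center A_c}c [c_center [x _ [A_c xc]]]].
have A0 : A !=set0 by exists c.
have [a [b [Aa Ab ab_diam]]] := diam_approx A0 A_bounded.
have r0 := radius_at_gt0 c A_nontrivial A_bounded.
have diamE : diam A = 2 * radius_at c A.
  by rewrite c_center A_centerable mulrA divff// mul1r.
have mid0 : (fun n => (c - a n) + (c - b n)) @ \oo --> (0 : X).
  (* The sum is read as the difference of [c - a n] and [b n - c], whose own sum [b n - a n] has
     norm tending to twice the radius. *)
  apply/norm_cvg0P; under eq_fun do rewrite -[c - b _]opprB.
  apply: (uniformly_convex_scale hX r0) => [n|n|]; first exact: radius_at_ub.
    by rewrite distrC; exact: radius_at_ub.
  under eq_fun do rewrite addrC subrKA distrC.
  by rewrite -diamE.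
have ab0 : (fun n => `|a n - b n|) @ \oo --> (0 : R).
  have abE n : `|a n - b n| = `|(x - a n) - (x - b n)|.
    by rewrite distrC -(subrKA x) addrC opprB.
  under eq_fun do rewrite abE.
  have rx0 := radius_at_gt0 x A_nontrivial A_bounded.
  apply: (uniformly_convex_scale hX rx0) => [n|n|]; try exact: radius_at_ub.
  (* Since [c] is farthest from [x], the target is the norm of [2(x - c)]; the added 0 stands for
     the limit in [mid0]. *)
  have -> : 2 * radius_at x A = `|(x - c) *+ 2 + 0|.
    by rewrite addr0 normrMn xc mulr_natl.
  rewrite (_ : (fun n => _) =
      (fun n => `|(x - c) *+ 2 + ((c - a n) + (c - b n))|)); last first.
    by apply/funext => n; rewrite mulr2n [in RHS]addrACA !subrKA.
  by apply: cvg_norm; apply: cvgD mid0; exact: cvg_cst.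
(* Uniqueness of limits makes the diameter 0, while [diamE] and [r0] make it positive. *)
have /eqP : diam A = 0 by exact: cvg_unique ab_diam ab0.
by rewrite diamE mulf_eq0 pnatr_eq0/= gt_eqF.
Qed.
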